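(* The following implications hold for ideals on countable sets: (1) All weakly selective ideals are weakly Ramsey. (2) All weakly Ramsey ideals are locally selective.
   Context: An ideal on a countable set $X$ is a collection $\mathcal{I}\subset\mathcal{P}(X)$ closed under subsets and finite unions, with $\mathcal{I}\neq\mathcal{P}(X)$ and containing all finite subsets of $X$. $\mathcal{I}^*=\{A\subset X: X\setminus A\in\mathcal{I}\}$ is the dual filter; a set $A\subset X$ is $\mathcal{I}$-positive if $A\notin\mathcal{I}$. A selector of a partition is a set containing exactly one point of each nonempty piece. An ideal $\mathcal{I}$ on $X$ is weakly selective if every partition $(X_n)_{n\in\omega}$ of $X$ with at most one element not in $\mathcal{I}$ and such that $\bigcup_{m\geq n}X_m\notin\mathcal{I}$ for each $n\in\omega$ has an $\mathcal{I}$-positive selector. $\mathcal{I}$ is locally selective if every partition $(X_n)_{n\in\omega}\subset\mathcal{I}$ of $X$ has an $\mathcal{I}$-positive selector. A tree is a nonempty set $T\subset X^{<\omega}$ of finite sequences of elements of $X$ closed under initial segments. The ramification of $T$ at $s\in T$ is $\{x\in X: s^\frown(x)\in T\}$. A branch of $T$ is a function $b:\omega\to X$ with $(b(0),\ldots,b(k))\in T$ for all $k\in\omega$; it is $\mathcal{I}$-positive if its range $b[\omega]$ is $\mathcal{I}$-positive. $\mathcal{I}$ is weakly Ramsey if every tree $T\subset X^{<\omega}$ with all ramifications in $\mathcal{I}^*$ has an $\mathcal{I}$-positive branch. *)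

(* Defs.v *)
From mathcomp Require Import all_boot.
From mathcomp Require Import boolp classical_sets functions cardinality.

Set Implicit Arguments.
Unset Strict Implicit.
Unset Printing Implicit Defensive.

Local Open Scope classical_set_scope.

Record is_ideal (X : Type) (I : set (set X)) : Prop := IsIdeal {
  ideal_sub : forall A B : set X, A `<=` B -> I B -> I A;
  ideal_setU : forall A B : set X, I A -> I B -> I (A `|` B);
  ideal_proper : I <> [set: set X];
  ideal_finite : forall A : set X, finite_set A -> I A }.

Definition dual_filter (X : Type) (I : set (set X)) : set (set X) :=
  [set A | I (~` A)].

Definition positive (X : Type) (I : set (set X)) (A : set X) : Prop := ~ I A.

(* Unlike in [classical_sets.partition], pieces may be empty, so that a
   partition into finitely many nonempty pieces can be indexed by [nat]. *)
Definition is_partition (X : Type) (P : nat -> set X) : Prop :=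
  cover [set: nat] P = [set: X] /\ trivIset [set: nat] P.

Definition is_selector (X : Type) (P : nat -> set X) (S : set X) : Prop :=
  forall n, P n !=set0 -> exists x, S `&` P n = [set x].

Definition weakly_selective (X : Type) (I : set (set X)) : Prop :=
  forall P : nat -> set X, is_partition P ->
    is_subset1 (range P `\` I) ->
    (forall n, ~ I (\bigcup_(m in [set m | (n <= m)%N]) P m)) ->
    exists2 S : set X, is_selector P S & positive I S.

Definition locally_selective (X : Type) (I : set (set X)) : Prop :=
  forall P : nat -> set X, is_partition P ->
    (forall n, I (P n)) ->
    exists2 S : set X, is_selector P S & positive I S.

Definition is_tree (X : Type) (T : set (seq X)) : Prop :=
  T !=set0 /\ forall s t : seq X, T (s ++ t) -> T s.

Definition ramification (X : Type) (T : set (seq X)) (s : seq X) : set X :=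
  [set x | T (rcons s x)].

Definition is_branch (X : Type) (T : set (seq X)) (b : nat -> X) : Prop :=
  forall k, T (mkseq b k.+1).

Definition weakly_Ramsey (X : Type) (I : set (set X)) : Prop :=
  forall T : set (seq X), is_tree T ->
    (forall s, T s -> dual_filter I (ramification T s)) ->
    exists2 b : nat -> X, is_branch T b & positive I (range b).

(* Main.v *)
Require Import Defs.
From mathcomp Require Import all_boot.
From mathcomp Require Import boolp classical_sets functions cardinality.

Set Implicit Arguments.
Unset Strict Implicit.
Unset Printing Implicit Defensive.

Local Open Scope classical_set_scope.

(** Weakly selective implies weakly Ramsey.  Fix an injective rank
    [h : X -> nat], and let [Z n] collect the points missing from the
    ramification of some node of [T] that is a rank-increasing sequence of
    ranks below [n].  There are finitely many such nodes, so [Z] is an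
    increasing sequence of sets of the ideal.  If a set [B], listed by
    increasing rank as [b 0, b 1, ...], avoids [Z 0] and satisfies
    [~ Z (h x).+1 y] whenever [x], [y] in [B] have [h x < h y], then its listing
    is a branch of [T].  So it suffices to find a positive such [B]
    ([positive_diagonal]), and weak selectivity is used twice for that.

    The first use only involves pieces in the ideal: the partition by the least
    [n] such that [x] lies in [Z n] or has rank below [n] has a positive selector
    [S], which meets each [Z n] in a finite set ([positive_finitely_meeting]).
    Hence, for fixed [x], all points of [S] of large enough rank avoid
    [Z (h x).+1]; cut the ranks into intervals so long that the interval after
    the one following that of [h x] is already large enough.  The second use
    applies to the partition into [X \ S], the one piece that may be positive,
    and the traces on [S] of these intervals, which are finite; it yields a
    positive subset of [S] with at most one point per interval.  Keeping only the even or only the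
    odd intervals preserves positivity for one of the two choices, and any two
    remaining points are separated by a full interval ([positive_spread_out]).

    Weakly Ramsey implies locally selective.  The finite sequences whose terms
    lie in distinct pieces form a tree whose ramifications omit finitely many
    pieces.  A positive branch meets each piece at most once, and is completed
    to a selector by choosing points in the pieces that it misses. *)

(** * Bounded and finite sets *)

Lemma ex_least (Q : nat -> Prop) : (exists n, Q n) ->
  exists n, Q n /\ forall k, Q k -> (n <= k)%N.
Proof.
move=> [n0 Qn0].
have exQ : exists n, `[< Q n >] by exists n0; apply/asboolP.
case: (ex_minnP exQ) => n /asboolP Qn least_n.
by exists n; split=> // k Qk; apply: least_n; apply/asboolP.
Qed.

Lemma finite_bounded (T : Type) (f : T -> nat) (A : set T) :
  finite_set A -> exists n, forall x, A x -> (f x < n)%N.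
Proof.
move=> /(finite_image f) /finite_seqP [s imE].
exists (\max_(i <- s) i).+1 => x Ax.
have fxs : f x \in s by have : [set` s] (f x) by rewrite -imE; exists x.
by rewrite ltnS (@leq_bigmax_seq _ s xpredT id).
Qed.

Lemma finite_inj_bounded (T : Type) (f : T -> nat) (A : set T) (n : nat) :
  (forall x y, A x -> A y -> f x = f y -> x = y) ->
  (forall x, A x -> (f x < n)%N) -> finite_set A.
Proof.
move=> f_inj f_lt.
have /eq_finite_set <- : (f @` A #= A)%card.
  by apply: inj_card_eq => x y; rewrite !inE => Ax Ay; apply: f_inj.
by apply: sub_finite_set (finite_II n) => _ [x Ax <-]; apply: f_lt.
Qed.

(** * Ideals and weak selectivity *)

Section Ideal.
Variables (X : Type) (I : set (set X)).
Hypothesis idI : is_ideal I.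

Lemma ideal_setT : ~ I setT.
Proof.
move=> IT; apply: (ideal_proper idI); rewrite predeqE => A; split=> // _.
exact: (ideal_sub idI) IT.
Qed.

Lemma ideal_bigcup (J : Type) (D : set J) (F : J -> set X) :
  finite_set D -> (forall j, D j -> I (F j)) -> I (\bigcup_(j in D) F j).
Proof.
move=> finD IF; rewrite -(@bigsetU_fset_set X {classic J}) //.
rewrite big_seq; elim/big_ind : _ => [|A B IA IB|j].
- exact: (ideal_finite idI) (finite_set0 _).
- exact: (ideal_setU idI).
- by rewrite in_fset_set // inE => /IF.
Qed.

Lemma positive_setD (A B : set X) : ~ I A -> I B -> ~ I (A `\` B).
Proof.
move=> IA IB IAB; apply: IA.
apply: (ideal_sub idI) (ideal_setU idI IAB IB) => x Ax.
by have [Bx|nBx] := pselect (B x); [right|left].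
Qed.

(** A partition indexed by [nat] is the family of fibers of a map to [nat], and a
    selector is a set on which this map is injective; the piece that may be
    positive is taken to be the fiber at [0]. *)
Lemma weakly_selective_fibers (c : X -> nat) : weakly_selective I ->
  (forall n, (0 < n)%N -> I [set x | c x = n]) ->
  (forall n, ~ I [set x | (n <= c x)%N]) ->
  exists2 S, ~ I S & forall x y, S x -> S y -> c x = c y -> x = y.
Proof.
move=> wsI Ifib Itail.
have [||n In|S selS posS] := wsI (fun n => [set x | c x = n]).
- split; first by rewrite predeqE => x; split=> // _; exists (c x).
  apply/trivIsetP => i j _ _ /eqP ij; rewrite predeqE => x; split=> //.
  by move=> -[/= ci cj]; case: ij; rewrite -ci.
- have zero n : ~ I [set x | c x = n] -> n = 0%N.
    by case: n => // n nI; case: nI; apply: Ifib.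
  by move=> _ _ [[i _ <-] /zero ->] [[j _ <-] /zero ->].
- apply: (Itail n); apply: (ideal_sub idI) In => x /= nx; by exists (c x).
- exists S => // x y Sx Sy cxy.
  have [|z Sz] := selS (c x); first by exists x.
  have -> : x = z by have : (S `&` [set t | c t = c x]) x by []; rewrite Sz.
  by have : (S `&` [set t | c t = c x]) y by []; rewrite Sz => ->.
Qed.

(** * Positive sets that grow fast along a rank *)

Section Rank.
Variable h : X -> nat.
Hypothesis h_inj : forall x y, h x = h y -> x = y.

Lemma ideal_rank_lt (A : set X) (n : nat) : (forall x, A x -> (h x < n)%N) -> I A.
Proof.
move=> hA; apply: (ideal_finite idI).
by apply: finite_inj_bounded hA => x y _ _ /h_inj.
Qed.

Lemma positive_unbounded (A : set X) (n : nat) : ~ I A -> exists2 x, A x & (n <= h x)%N.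
Proof.
move=> IA; apply: contra_notP IA => nA; apply: (@ideal_rank_lt _ n) => x Ax.
by rewrite ltnNge; apply/negP => nx; apply: nA; exists x.
Qed.

(** Partition [X] according to the first [W n] that contains a point: a selector has
    at most one point for each value up to [n], hence meets [W n] in a finite
    set.  The tails of this partition are positive because their complements are
    covered by some [W n]. *)
Lemma positive_finitely_meeting (W : nat -> set X) : weakly_selective I ->
  (forall n, I (W n)) -> (forall m n, (m <= n)%N -> W m `<=` W n) ->
  (forall x, exists n, W n x) ->
  exists2 S, ~ I S & forall n, finite_set (S `&` W n).
Proof.
move=> wsI IW W_mono W_cover.
have [c cP] := choice (fun x => ex_least (W_cover x)).
have fibW n : [set x | c x = n] `<=` W n by move=> x <-; case: (cP x).
have [n _|n In|S posS S_inj] := weakly_selective_fibers (c := c) wsI.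
- exact: (ideal_sub idI) (fibW n) (IW n).
- apply: ideal_setT; apply: (ideal_sub idI) (ideal_setU idI In (IW n)) => x _ /=.
  have [nx|xn] := leqP n (c x); [by left|right].
  by case: (cP x) => /(W_mono _ _ (ltnW xn)).
- exists S => // n; apply: (@finite_inj_bounded _ c _ n.+1) => [x y|x [_ Wx]].
    by move=> [Sx _] [Sy _]; apply: S_inj.
  by rewrite ltnS; case: (cP x) => _; apply.
Qed.

(** The values of [m] cut the ranks into finite intervals.  A selector gives points
    in distinct intervals, and restricting to intervals of one parity makes
    these intervals non-adjacent, so that a full one lies between any two. *)
Lemma positive_spread_out (S : set X) (m : nat -> nat) : weakly_selective I -> ~ I S ->
  (forall k, (m k < m k.+1)%N) ->
  exists B, [/\ B `<=` S, ~ I B & forall x y, B x -> B y -> (h x < h y)%N ->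
    exists2 k, (h x < m k)%N & (m k.+1 <= h y)%N].
Proof.
move=> wsI posS m_incr.
have m_mono : {homo m : i j / (i <= j)%N} :=
  homo_leq leqnn leq_trans (fun k => ltnW (m_incr k)).
have m_unb x : exists k, (h x < m k)%N.
  exists (h x).+1; elim: (h x).+1 => // k; rewrite -ltnS => km.
  exact: leq_trans km (m_incr k).
have [d dP] := choice (fun x => ex_least (m_unb x)).
have d_lt x k : (k < d x)%N -> (m k <= h x)%N.
  by move=> kd; rewrite leqNgt; apply/negP => /(proj2 (dP x)); rewrite leqNgt kd.
have h_lt x k : (d x <= k)%N -> (h x < m k)%N.
  by move=> dk; apply: leq_trans (proj1 (dP x)) (m_mono _ _ dk).
(* The complement of [S] is the fiber of [c] at [0], so that the traces of the
   intervals on [S], which are finite, fill the other fibers; points of rank below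
   [m 0] join the fiber at [0], the only one allowed to be positive. *)
pose c x := if `[< S x >] then d x else 0.
have cS x : S x -> c x = d x by move=> Sx; rewrite /c; case: asboolP.
have cN x : ~ S x -> c x = 0 by move=> Sx; rewrite /c; case: asboolP.
have [n n_gt0|n In|S' posS' S'_inj] := weakly_selective_fibers (c := c) wsI.
- apply: (@ideal_rank_lt _ (m n)) => x /= cx; apply: h_lt.
  have [Sx|Sx] := pselect (S x); first by rewrite -cx cS.
  by move: n_gt0; rewrite -cx cN.
- apply: (positive_setD posS In); apply: (@ideal_rank_lt _ (m n)) => x [Sx /= /negP].
  by rewrite -ltnNge cS // => /ltnW; apply: h_lt.
(* [S'] is injective for [c], so it has at most one point outside [S]; one of its
   two halves by parity of the interval is therefore positive. *)
have posB : exists b : bool, ~ I (S' `&` S `&` [set x | odd (d x) = b]).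
  apply/not_existsP => Ib; apply: posS'.
  have Ipar b := contrapT (Ib b).
  have Irest : I (S' `\` S).
    apply: (ideal_finite idI); apply: (@finite_inj_bounded _ c _ 1).
      by move=> x y [S'x _] [S'y _]; apply: S'_inj.
    by move=> x [_ /cN ->].
  have IU := ideal_setU idI Irest (ideal_setU idI (Ipar true) (Ipar false)).
  apply: (ideal_sub idI) IU => x S'x.
  have [Sx|Sx] := pselect (S x); last by left.
  by right; case E: (odd (d x)); [left|right].
have [b posb] := posB.
exists (S' `&` S `&` [set x | odd (d x) = b]); split=> //; first by move=> x [[]].
move=> x y [[S'x Sx] /= oddx] [[S'y Sy] /= oddy] hxy.
exists (d x); first exact: h_lt.
apply: (d_lt).
have : (d x <= d y)%N.
  by rewrite leqNgt; apply/negP => /d_lt; rewrite leqNgt (ltn_trans hxy) ?h_lt.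
rewrite leq_eqVlt => /orP[/eqP dxy|].
  by move: hxy; rewrite (S'_inj x y) ?ltnn // !cS.
rewrite leq_eqVlt => /orP[/eqP dxy|//].
by move: oddy; rewrite -dxy /= oddx; case: (b).
Qed.

(** A positive set meeting each [Z n] finitely needs thinning out: a point [x] only
    controls the points far beyond it, so the set given by
    [positive_finitely_meeting] is spread out at a matching speed. *)
Lemma positive_diagonal (Z : nat -> set X) : weakly_selective I ->
  (forall n, I (Z n)) -> (forall m n, (m <= n)%N -> Z m `<=` Z n) ->
  exists2 B, ~ I B & (forall x, B x -> ~ Z 0 x) /\
    forall x y, B x -> B y -> (h x < h y)%N -> ~ Z (h x).+1 y.
Proof.
move=> wsI IZ Z_mono.
(* Adding the points of small rank makes the sets cover [X]. *)
pose W n := Z n `|` [set x | (h x < n)%N].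
have [n|i j ij x [Zx|hx]|x|S posS finS] := positive_finitely_meeting (W := W) wsI.
- by apply: (ideal_setU idI) => //; apply: (@ideal_rank_lt _ n).
- by left; apply: Z_mono ij _ Zx.
- by right; apply: leq_trans hx ij.
- by exists (h x).+1; right => /=.
have [g gP] := choice (fun n => finite_bounded h (finS n)).
(* Beyond rank [g n], the set [S] avoids [Z n]; the endpoint [m k.+1] is past
   [g (m k)], so one interval after [h x < m k] is enough to leave [Z (h x).+1]. *)
pose m := fix m k := if k is k.+1 then maxn (m k).+1 (g (m k)) else 0.
have [k|B [BS posB Bsep]] := positive_spread_out (m := m) wsI posS.
  exact: leq_maxl.
exists (B `\` Z 0); first exact: positive_setD.
split=> [x []//|x y [Bx _] [By _] hxy Zy].
have [k hxk] := Bsep _ _ Bx By hxy.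
rewrite leqNgt => /negP; apply; apply: leq_trans (leq_maxr _ _).
by apply: gP; split; [exact: BS|left; apply: Z_mono hxk _ Zy].
Qed.

Lemma enumerate_by_rank (B : set X) : ~ I B -> exists b : nat -> X,
  range b = B /\ forall k, (h (b k) < h (b k.+1))%N.
Proof.
move=> posB.
have ex n : exists x, B x /\ (n <= h x)%N /\
    forall y, B y -> (n <= h y)%N -> (h x <= h y)%N.
  have [|r [[x Bx [nx xr]] r_least]] :=
      ex_least (Q := fun r => exists2 x, B x & (n <= h x)%N /\ h x = r).
    by have [x Bx nx] := positive_unbounded n posB; exists (h x), x.
  by exists x; split=> //; split=> // y By ny; rewrite xr; apply: r_least; exists y.
have [next nextP] := choice ex.
pose b := fix b k := if k is k.+1 then next (h (b k)).+1 else next 0.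
have b_incr k : (h (b k) < h (b k.+1))%N by case: (nextP (h (b k)).+1) => _ [].
exists b; split=> //; rewrite predeqE => x; split.
  by move=> [[|k] _ <-]; [case: (nextP 0)|case: (nextP (h (b k)).+1)].
move=> Bx.
(* If [b k] is the first term of rank at least [h x], then [x] is a candidate at
   the step that selects [b k], which has the least rank among candidates. *)
have [|k [xk k_least]] := ex_least (Q := fun k => (h x <= h (b k))%N).
  exists (h x); elim: (h x) => // k kb; exact: leq_ltn_trans kb (b_incr k).
exists k => //; apply/h_inj/eqP; rewrite eqn_leq xk andbT.
case: k xk k_least => [_ _|k _ k_least].
  by case: (nextP 0) => _ [_]; apply.
case: (nextP (h (b k)).+1) => _ [_]; apply => //.
by rewrite ltnNge; apply/negP => /k_least; rewrite ltnn.
Qed.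

(** * Trees with large ramifications *)

(** Recursion on the bound, rather than a sortedness predicate, makes the
    finiteness of this set of sequences immediate. *)
Fixpoint increasing_below n : set (seq X) :=
  if n is m.+1 then
    increasing_below m `|`
    [set rcons s x | s in increasing_below m & x in [set x | h x = m]]
  else [set [::]].

Lemma finite_increasing_below n : finite_set (increasing_below n).
Proof.
elim: n => [|n IHn] /=; first exact: finite_set1.
rewrite finite_setU; split=> //; apply: finite_image2 => //.
by apply: (@finite_inj_bounded _ h _ n.+1) => [x y _ _ /h_inj|x /= ->].
Qed.

Lemma increasing_below_mono m n : (m <= n)%N ->
  increasing_below m `<=` increasing_below n.
Proof.
move=> /subnK <-; elim: (n - m)%N => // k IHk s ms.
by left; apply: IHk.
Qed.

Lemma increasing_below_mkseq (b : nat -> X) k :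
  (forall k, (h (b k) < h (b k.+1))%N) ->
  increasing_below (h (b k)).+1 (mkseq b k.+1).
Proof.
move=> b_incr.
have step j : increasing_below (h (b j)) (mkseq b j) ->
    increasing_below (h (b j)).+1 (mkseq b j.+1).
  by move=> ms; right; exists (mkseq b j) => //; exists (b j) => //; rewrite mkseqS.
apply: (step); elim: k => [|k /step IHk].
  exact: (increasing_below_mono (leq0n _)).
exact: (increasing_below_mono (b_incr k)).
Qed.

(** The initial segment [b 0, ..., b k] of an increasing listing is one of the nodes
    used to define [Z (h (b k)).+1], so [b k.+1] avoiding that set is exactly
    what puts the next segment in [T]. *)
Lemma weakly_selective_weakly_Ramsey_rank : weakly_selective I -> weakly_Ramsey I.
Proof.
move=> wsI T [[t0 Tt0] Tcl] Tram.
have Tnil : T [::] by apply: (Tcl [::] t0).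
pose Z n := \bigcup_(s in increasing_below n `&` T) ~` ramification T s.
have [n|m n mn x [s [ms Ts] nx]|B posB [B0 Bdiag]] := positive_diagonal (Z := Z) wsI.
- apply: ideal_bigcup; first exact: finite_setIl (finite_increasing_below n).
  by move=> s [_ /Tram].
- by exists s => //; split=> //; apply: increasing_below_mono mn _ ms.
have [b [bB b_incr]] := enumerate_by_rank posB.
have Bb k : B (b k) by rewrite -bB; exists k.
exists b; last by rewrite /positive bB.
elim=> [|k IHk].
  apply: contrapT => nT; apply: (B0 (b 0) (Bb 0)).
  by exists [::].
apply: contrapT => nT; apply: (Bdiag _ _ (Bb k) (Bb k.+1) (b_incr k)).
exists (mkseq b k.+1); first by split=> //; apply: increasing_below_mkseq.
by move=> Tk; apply: nT; rewrite mkseqS.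
Qed.

End Rank.

(** * From branches to selectors *)

Lemma weakly_Ramsey_locally_selective : weakly_Ramsey I -> locally_selective I.
Proof.
move=> wRI P [Pcov Ptriv] IP.
have Pex x : exists n, P n x.
  have : cover setT P x by rewrite Pcov.
  by move=> [n _ Px]; exists n.
have [c cP] := choice Pex.
have cE n x : P n x -> c x = n.
  by move=> Px; apply: Ptriv => //; exists x.
pose T := [set s | uniq (map c s)].
have [|s Ts|b bT posb] := wRI T.
- split; first by exists [::].
  by move=> s t; rewrite /T /= map_cat cat_uniq => /andP[].
- rewrite /dual_filter /=.
  have IU := ideal_bigcup (F := P) (finite_seq (map c s)) (fun n _ => IP n).
  apply: (ideal_sub idI) IU.
  move=> x; rewrite /ramification /T /= map_rcons rcons_uniq => /negP.
  by rewrite Ts andbT negbK => cs; exists (c x).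
have b_inj i j : (i < j)%N -> c (b i) <> c (b j).
  move=> ij cij; have := bT j; rewrite mkseqS /T /= map_rcons rcons_uniq.
  move=> /andP[/negP + _].
  by apply; rewrite -cij /mkseq -map_comp (map_f (c \o b)) // mem_iota.
have rex n : exists x, P n !=set0 -> P n x.
  by have [[x Px]|nP] := pselect (P n !=set0); [exists x|exists (b 0)].
have [r rP] := choice rex.
exists (range b `|` [set x | x = r (c x) /\ ~ exists i, c (b i) = c x]); last first.
  by move=> IS; apply: posb; apply: (ideal_sub idI) IS; left.
move=> n Pn; have [[i cbi]|nb] := pselect (exists i, c (b i) = n).
  exists (b i); rewrite predeqE => x; split=> [[[[j _ <-]|[_ nbx]] /cE cx]|->].
  - have [ij|ji|-> //] := ltngtP i j; last by case: (b_inj _ _ ji); rewrite cx cbi.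
    by case: (b_inj _ _ ij); rewrite cx cbi.
  - by case: nbx; exists i; rewrite cx.
  - by split; [left; exists i|rewrite -cbi; apply: cP].
have Prn := rP n Pn.
exists (r n); rewrite predeqE => x; split=> [[[[j _ <-]|[xr _]] /cE cx]|->].
- by case: nb; exists j.
- by rewrite xr cx.
- by split=> //; right; rewrite /= (cE _ _ Prn).
Qed.

End Ideal.

Theorem corollary3p4 :
  (forall (X : Type) (I : set (set X)),
     countable [set: X] -> is_ideal I ->
     weakly_selective I -> weakly_Ramsey I)
  /\
  (forall (X : Type) (I : set (set X)),
     countable [set: X] -> is_ideal I ->
     weakly_Ramsey I -> locally_selective I).
Proof.
split=> X I; last by move=> _; apply: weakly_Ramsey_locally_selective.
move=> /countable_injP [h h_inj] idI.
apply: (weakly_selective_weakly_Ramsey_rank idI (h := h)) => x y.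
by apply: h_inj; rewrite inE.
Qed.
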